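(* Let $n \geq 2$, $1 \leq k \leq m + 1$, and let $f = \frac{p}{q} \colon \mathbb{C}^n \dashrightarrow \mathbb{C}^N$ be a rational $k$-fold sphere map of degree $m$ in reduced terms, that is, it takes the sphere of radius $r_j$ to the sphere of radius $R_j$ (both centered at the origin), where all $r_j$ are distinct and $r_j, R_j > 0$ for $j = 1, \dots, k$. Let $Q_0(z, \bar{z}) = \lVert p(z)\rVert^2$. Then for $j = 1, \dots, k$ there is (successively) a real polynomial $Q_j(z, \bar{z})$ of bidegree at most $(m-j, m-j)$ such that $$Q_{j-1}(z, \bar{z}) - \left.\frac{Q_{j-1}(z, \bar{z})}{|q(z)|^2}\right|_{\lVert z\rVert = r_j} |q(z)|^2 = Q_j(z, \bar{z}) \bigl(\lVert z\rVert^2 - r_j^2\bigr),$$ where the function restricted to $\lVert z\rVert=r_j$ is constant and equal to $b_{j-1}$, so that this becomes $$Q_{j-1}(z, \bar{z}) - b_{j-1} |q(z)|^2 = Q_j(z, \bar{z}) \bigl(\lVert z\rVert^2 - r_j^2\bigr),$$ and for $\ell = j + 1, \dots, k$, $\frac{Q_j(z, \bar{z})}{|q(z)|^2}$ is constant on the sphere $\lVert z\rVert=r_\ell$ and equals $[R_1^2, \dots, R_j^2, R_\ell^2]$. Moreover, for $j\in\{1,\dots,k-1\}$, if $b_j \neq 0$, then $q(z)$ is of degree at most $m - j$.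
   Context: A rational map $f \colon \mathbb{C}^n \dashrightarrow \mathbb{C}^N$ is a $k$-fold sphere map if there exist $k$ distinct numbers $r_j>0$ and numbers $R_j>0$ ($j=1,\dots,k$) such that the pole set of $f$ misses the spheres $r_jS^{2n-1}$ and $f(r_jS^{2n-1}) \subset R_jS^{2N-1}$ for all $j$, where $S^{2n-1}$ is the unit sphere of $\mathbb{C}^n$. $f=\frac{p}{q}$ in reduced terms means $p\colon\mathbb{C}^n\to\mathbb{C}^N$ and $q\colon\mathbb{C}^n\to\mathbb{C}$ are polynomial with no nonconstant common factor; the degree of $f$ is $\max(\deg p,\deg q)$. Divided differences: $[R_j^2] = R_j^2$ for $j=1,\dots,k$, and $$[R_1^2, \dots, R_j^2, R_\ell^2] = \frac{[R_1^2, \dots, R_{j-1}^2, R_\ell^2] - [R_1^2, \dots, R_{j-1}^2, R_j^2]}{r_\ell^2 - r_j^2}, \quad \ell = j + 1, \dots, k,\ j = 1, \dots, k - 1.$$ Set $b_0=[R_1^2]$ and $b_j = [R_1^2, \dots, R_j^2, R_{j+1}^2]$ for $j=1,\dots,k-1$. The bidegree of a polynomial $Q(z,\bar z)$ is the pair (degree in $z$, degree in $\bar z$). The zero polynomial is regarded as having bidegree $(-1,-1)$. A real polynomial $Q(z,\bar z)$ is a real-valued polynomial in $z,\bar z$. *)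

(* Defs.v *)
From HB Require Import structures.
From mathcomp Require Import all_boot all_order all_algebra.
From mathcomp Require Import reals complex.
From mathcomp Require Import mpoly.

Set Implicit Arguments.
Unset Strict Implicit.
Unset Printing Implicit Defensive.

Import Order.TTheory GRing.Theory Num.Theory.

Local Open Scope ring_scope.
Local Open Scope complex_scope.

(** The complex numbers are [K[i]], with [K : realType] the real numbers, and a
    point of C^n is a function ['I_n -> K[i]]. *)

Definition enorm (K : realType) (n : nat) (z : 'I_n -> K[i]) : K :=
  Num.sqrt (\sum_(i < n) (complex.Re (z i) ^+ 2 + complex.Im (z i) ^+ 2)).

(** A polynomial map C^n -> C^N is its family of components. *)
Definition peval (K : realType) (n N : nat) (p : 'I_N -> {mpoly K[i][n]})
  (z : 'I_n -> K[i]) : 'I_N -> K[i] := fun i => (p i).@[z].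

(** [p / q] at [z]; meaningful only where [q] does not vanish. *)
Definition ratmap (K : realType) (n N : nat) (p : 'I_N -> {mpoly K[i][n]})
  (q : {mpoly K[i][n]}) (z : 'I_n -> K[i]) : 'I_N -> K[i] :=
  fun i => (p i).@[z] / q.@[z].

(** The zero polynomial gets degree 0 here, which does not affect
    [ratmap_degree] as soon as [q != 0]. *)
Definition pdeg (K : realType) (n : nat) (g : {mpoly K[i][n]}) : nat :=
  (msize g).-1.

Definition ratmap_degree (K : realType) (n N : nat)
  (p : 'I_N -> {mpoly K[i][n]}) (q : {mpoly K[i][n]}) : nat :=
  maxn (\max_(i < N) pdeg (p i)) (pdeg q).

Definition mpoly_dvd (K : realType) (n : nat) (d g : {mpoly K[i][n]}) : Prop :=
  exists h : {mpoly K[i][n]}, g = d * h.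

Definition reduced (K : realType) (n N : nat) (p : 'I_N -> {mpoly K[i][n]})
  (q : {mpoly K[i][n]}) : Prop :=
  q != 0 /\
  forall d : {mpoly K[i][n]},
    (forall i, mpoly_dvd d (p i)) -> mpoly_dvd d q -> pdeg d = 0%N.

(** Radii are indexed by [1, ..., k]; the values of [r] and [R] at other indices
    play no role. For [p / q] in reduced terms the pole set is the zero set of
    [q]. *)
Definition sphere_map (K : realType) (n N : nat) (p : 'I_N -> {mpoly K[i][n]})
  (q : {mpoly K[i][n]}) (k : nat) (r R : nat -> K) : Prop :=
  [/\ forall j, (1 <= j <= k)%N -> 0 < r j /\ 0 < R j,
      forall i j, (1 <= i <= k)%N -> (1 <= j <= k)%N -> r i = r j -> i = j
    & forall j, (1 <= j <= k)%N -> forall z, enorm z = r j ->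
        q.@[z] != 0 /\ enorm (ratmap p q z) = R j].

(** [divdiff r R j l] is [[R_1^2, ..., R_j^2, R_l^2]], for [l > j]. *)
Fixpoint divdiff (K : realType) (r R : nat -> K) (j l : nat) : K :=
  if j is j'.+1 then
    (divdiff r R j' l - divdiff r R j' j) / (r l ^+ 2 - r j ^+ 2)
  else R l ^+ 2.

Definition bcoef (K : realType) (r R : nat -> K) (j : nat) : K :=
  divdiff r R j j.+1.

(** A polynomial Q(z, zbar) is an element of [{mpoly K[i][n + n]}]: variable
    [lshift n i] stands for z_i and variable [rshift n i] for the conjugate
    of z_i. *)
Definition zvar (K : realType) (n : nat) (i : 'I_n) : {mpoly K[i][n + n]} :=
  'X_(lshift n i).

Definition zbarvar (K : realType) (n : nat) (i : 'I_n) : {mpoly K[i][n + n]} :=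
  'X_(rshift n i).

Definition zzbar (K : realType) (n : nat) (z : 'I_n -> K[i]) :
  'I_(n + n) -> K[i] :=
  fun i => match split i with inl j => z j | inr j => (z j)^* end.

Definition real_poly (K : realType) (n : nat) (Q : {mpoly K[i][n + n]}) : Prop :=
  forall z : 'I_n -> K[i], Q.@[zzbar z] \is Num.real.

Definition bidegree (K : realType) (n : nat) (Q : {mpoly K[i][n + n]}) :
  int * int :=
  if Q == 0 then (- 1, - 1)
  else (Posz (\max_(a <- msupp Q) \sum_(i < n) a (lshift n i))%N,
        Posz (\max_(a <- msupp Q) \sum_(i < n) a (rshift n i))%N).

(** The polynomials in (z, zbar) giving |g(z)|^2, ||p(z)||^2 and ||z||^2; see
    the evaluation lemmas below. *)
Definition sqmod (K : realType) (n : nat) (g : {mpoly K[i][n]}) :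
  {mpoly K[i][n + n]} :=
  (g \mPo [tuple zvar K i | i < n])
  * (map_mpoly (@conjc K) g \mPo [tuple zbarvar K i | i < n]).

Definition sqnorm (K : realType) (n N : nat) (p : 'I_N -> {mpoly K[i][n]}) :
  {mpoly K[i][n + n]} :=
  \sum_(i < N) sqmod (p i).

Definition sqnormz (K : realType) (n : nat) : {mpoly K[i][n + n]} :=
  \sum_(i < n) zvar K i * zbarvar K i.

Lemma zzbar_lshift (K : realType) (n : nat) (z : 'I_n -> K[i]) (i : 'I_n) :
  zzbar z (lshift n i) = z i.
Proof. by rewrite /zzbar (unsplitK (inl i)). Qed.

Lemma zzbar_rshift (K : realType) (n : nat) (z : 'I_n -> K[i]) (i : 'I_n) :
  zzbar z (rshift n i) = (z i)^*.
Proof. by rewrite /zzbar (unsplitK (inr i)). Qed.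

Lemma meval_conj (K : realType) (n : nat) (g : {mpoly K[i][n]})
  (z : 'I_n -> K[i]) :
  (map_mpoly (@conjc K) g).@[fun i => (z i)^*] = (g.@[z])^*.
Proof.
rewrite !mevalE (perm_big _ (msupp_map_mpoly g (can_inj (@conjcK K)))) /=.
rewrite rmorph_sum; apply: eq_bigr => m _.
rewrite mcoeff_map_mpoly rmorphM rmorph_prod /=; congr (_ * _).
by apply: eq_bigr => i _; rewrite rmorphXn.
Qed.

Lemma sqmodE (K : realType) (n : nat) (g : {mpoly K[i][n]}) (z : 'I_n -> K[i]) :
  (sqmod g).@[zzbar z] = `|g.@[z]| ^+ 2.
Proof.
rewrite sqr_normc -(meval_conj g z) /sqmod mevalM; congr (_ * _).
  rewrite [LHS]comp_mpoly_meval; apply: meval_eq => i.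
  by rewrite tnth_map tnth_ord_tuple mevalXU zzbar_lshift.
rewrite [LHS]comp_mpoly_meval; apply: meval_eq => i.
by rewrite tnth_map tnth_ord_tuple mevalXU zzbar_rshift.
Qed.

Lemma enorm_sqr (K : realType) (n : nat) (z : 'I_n -> K[i]) :
  (enorm z ^+ 2)%:C = \sum_(i < n) `|z i| ^+ 2.
Proof.
rewrite /enorm sqr_sqrtr; last first.
  by apply: sumr_ge0 => i _; rewrite addr_ge0 ?sqr_ge0.
by rewrite raddf_sum /=; apply: eq_bigr => i _; rewrite -add_Re2_Im2.
Qed.

Lemma sqnormE (K : realType) (n N : nat) (p : 'I_N -> {mpoly K[i][n]})
  (z : 'I_n -> K[i]) :
  (sqnorm p).@[zzbar z] = (enorm (peval p z) ^+ 2)%:C.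
Proof.
by rewrite enorm_sqr /sqnorm raddf_sum; apply: eq_bigr => i _; apply: sqmodE.
Qed.

Lemma sqnormzE (K : realType) (n : nat) (z : 'I_n -> K[i]) :
  (sqnormz K n).@[zzbar z] = (enorm z ^+ 2)%:C.
Proof.
rewrite enorm_sqr /sqnormz raddf_sum; apply: eq_bigr => i _.
by rewrite [LHS]mevalM !mevalXU zzbar_lshift zzbar_rshift sqr_normc.
Qed.

(* Main.v *)
(** A polynomial [P(z, zbar)] of bidegree at most [(D, D)] that vanishes on
    [||z|| = r] is divisible by [||z||^2 - r^2], with a quotient of bidegree at
    most [(D - 1, D - 1)].  Indeed, by the action of the unit circle each part
    of [P] of fixed [zdeg - zbardeg] vanishes on the sphere; multiplying its
    monomials by suitable powers of [||z||^2 / r^2] makes it bihomogeneous, so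
    by scaling it vanishes everywhere.  As [(||z||^2 / r^2) ^ e - 1] is a
    multiple of [||z||^2 - r^2], this gives the quotient explicitly.

    In the induction, [Q_j - b_j |q|^2] vanishes on the next sphere.  When
    [b_j != 0], the bound on the degree of [q] holds because otherwise the top
    part of [|q|^2] would be divisible by [z . zbar], which for [n >= 2] has
    zeros where that part does not vanish. *)

Require Import Defs.
From HB Require Import structures.
From mathcomp Require Import all_boot all_order all_algebra.
From mathcomp Require Import reals complex.
From mathcomp Require Import mpoly.
From mathcomp Require Import ring zify.

Set Implicit Arguments.
Unset Strict Implicit.
Unset Printing Implicit Defensive.

Import Order.TTheory GRing.Theory Num.Theory.

Local Open Scope ring_scope.
Local Open Scope complex_scope.

(** * Nonvanishing of polynomials at natural points *)

(** Uniqueness of base-[B] digits: reduction modulo [B] gives the lowest digit, division by [B]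
    shifts the others. *)
Lemma sum_expn_inj (B n : nat) (f g : nat -> nat) :
  (forall i, (i < n)%N -> (f i < B)%N) -> (forall i, (i < n)%N -> (g i < B)%N) ->
  (\sum_(i < n) f i * B ^ i = \sum_(i < n) g i * B ^ i)%N ->
  forall i, (i < n)%N -> f i = g i.
Proof.
elim: n f g => [//|n IHn] f g fB gB.
have shift (h : nat -> nat) : (\sum_(i < n.+1) h i * B ^ i =
    (\sum_(i < n) h i.+1 * B ^ i) * B + h 0)%N.
  rewrite big_ord_recl expn0 muln1 addnC big_distrl /=; congr (_ + _)%N.
  by apply: eq_bigr => i _; rewrite expnSr mulnA.
rewrite !shift => eqfg.
have f0B := fB 0%N isT; have g0B := gB 0%N isT.
have /= eq0 : f 0%N = g 0%N.
  by have := congr1 (modn^~ B) eqfg; rewrite !modnMDl !modn_small.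
have B0 : (0 < B)%N by apply: leq_ltn_trans f0B.
move: eqfg; rewrite eq0 => /addIn /eqP; rewrite eqn_pmul2r // => /eqP eqfg.
case=> [//|i] lti.
by apply: (IHn (fun i => f i.+1) (fun i => g i.+1)) eqfg _ _ => // j ltj;
  [apply: fB | apply: gB].
Qed.

Lemma poly_eq0_inj (F : idomainType) (t : nat -> F) (h : {poly F}) :
  injective t -> (forall i, h.[t i] = 0) -> h = 0.
Proof.
move=> tI ht; apply/eqP/negPn/negP => h0.
have := @max_poly_roots _ h [seq t i | i <- iota 0 (size h)] h0.
rewrite size_map size_iota ltnn => abs; apply/notF/abs.
  by apply/allP => _ /mapP[i _ ->]; rewrite /root ht.
by rewrite (map_inj_uniq tI) iota_uniq.
Qed.

(* Kronecker substitution: for [B] above every exponent of [P], the monomials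
   of [P] stay distinct under [X_i |-> T ^ (B ^ i)]. *)
Lemma mpoly_neq0_nat (F : numDomainType) (n : nat) (P : {mpoly F[n]}) :
  P != 0 -> exists v : 'I_n -> nat, P.@[fun i => (v i)%:R] != 0.
Proof.
move=> P0; pose B := msize P.
pose code (m : 'X_{1..n}) := (\sum_(i < n) m i * B ^ i)%N.
have codeI m1 m2 : m1 \in msupp P -> m2 \in msupp P ->
    code m1 = code m2 -> m1 = m2.
  move=> m1P m2P eqc; apply/mnmP => i.
  have bound (m : 'X_{1..n}) : m \in msupp P -> forall j : 'I_n, (m j < B)%N.
    move=> mP j; apply: leq_ltn_trans (msize_mdeg_lt mP).
    by rewrite mdegE (bigD1 j) //= leq_addr.
  pose ext (m : 'X_{1..n}) (j : nat) := if insub j is Some k then m k else 0%N.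
  have extE m (j : 'I_n) : ext m j = m j by rewrite /ext valK.
  have extB m : m \in msupp P -> forall j, (j < n)%N -> (ext m j < B)%N.
    by move=> mP j ltj; rewrite (extE m (Ordinal ltj)) bound.
  rewrite -!extE; apply: (@sum_expn_inj B n) => //; [exact: extB|exact: extB|].
  rewrite (eq_bigr (fun j : 'I_n => (m1 j * B ^ j)%N)) => [|j _]; last by rewrite extE.
  by rewrite [LHS]eqc; apply: eq_bigr => j _; rewrite extE.
pose h : {poly F} := \sum_(m <- msupp P) P@_m *: 'X^(code m).
have hE (t : nat) : h.[t%:R] = P.@[fun i => (t ^ (B ^ i))%:R].
  rewrite mevalE /h horner_sum; apply: eq_bigr => m _.
  rewrite hornerZ hornerXn; congr (_ * _); rewrite /code expr_sum.
  by apply: eq_bigr => i _; rewrite natrX -exprM mulnC.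
(* Codes are distinct on [msupp P], so the coefficient of [h] at [code m0] is the single coefficient
   [P@_m0]. *)
have h0 : h != 0.
  apply: contraNneq P0 => h0; rewrite -msupp_eq0; apply/eqP.
  case E: (msupp P) => [//|m0 s].
  have m0P : m0 \in msupp P by rewrite E mem_head.
  have := congr1 (fun g : {poly F} => g`_(code m0)) h0.
  rewrite /h coef_sum (bigD1_seq m0) ?msupp_uniq //= big_seq_cond big1.
    by rewrite coefZ coefXn eqxx mulr1 addr0 coef0 => /eqP;
      rewrite -[_ == _]negbK -mcoeff_msupp m0P.
  move=> m /andP[mP neqm]; rewrite coefZ coefXn;
    case: eqP => [/(codeI _ _ m0P mP) eqm|]; last by rewrite mulr0.
  by rewrite eqm eqxx in neqm.
have [t ht] : exists t : nat, h.[t%:R] != 0.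
  have [//|none] := boolp.pselect (exists t : nat, h.[t%:R] != 0).
  case/eqP: h0; apply: (@poly_eq0_inj _ (fun t : nat => t%:R)).
    by move=> t1 t2 /eqP; rewrite eqr_nat => /eqP.
  by move=> t; apply/eqP/negPn/negP => ht; apply: none; exists t.
by exists (fun i : 'I_n => (t ^ (B ^ i))%N); rewrite -hE.
Qed.

(** * Polynomials in z and zbar are determined by their values *)

Lemma conj_natDi (K : realType) (s t : nat) :
  (s%:R + 'i * t%:R : K[i])^* = s%:R - 'i * t%:R.
Proof.
rewrite rmorphD rmorphM !rmorph_nat -mulNr.
by congr (_ + _ * _); apply/eqP; rewrite eq_complex /= oppr0 !eqxx.
Qed.

(** The substitution [T] is [z = x + i y], [zbar = x - i y]. Natural [x], [y] give genuine points
    [zzbar z], so [Q \mPo T] vanishes at all natural points and is 0. Since [T] is invertible, [Q]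
    then vanishes at all points. *)
Lemma zzbar_eq0 (K : realType) (n : nat) (Q : {mpoly K[i][n + n]}) :
  (forall z, Q.@[zzbar z] = 0) -> Q = 0.
Proof.
move=> Qz.
pose T := [tuple match split k with
                 | inl j => zvar K j + ('i)%:MP * zbarvar K j
                 | inr j => zvar K j - ('i)%:MP * zbarvar K j end | k < n + n].
have TE v : (Q \mPo T).@[v] = Q.@[fun k => match split k with
    | inl j => v (lshift n j) + 'i * v (rshift n j)
    | inr j => v (lshift n j) - 'i * v (rshift n j) end].
  rewrite [LHS]comp_mpoly_meval; apply: meval_eq => k.
  rewrite tnth_map tnth_ord_tuple.
  by case: (split k) => j; rewrite ?mevalB ?mevalD mevalM mevalC !mevalXU.
have QT0 : Q \mPo T = 0.
  apply/eqP/negPn/negP => /mpoly_neq0_nat[v]; rewrite TE => /eqP; apply.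
  rewrite -[RHS](Qz (fun j => (v (lshift n j))%:R + 'i * (v (rshift n j))%:R)).
  apply: meval_eq => k; rewrite /zzbar; case: (split k) => j //.
  by rewrite conj_natDi.
apply/eqP/negPn/negP => /mpoly_neq0_nat[v] /eqP; apply.
(* [w] is the preimage of [v] under [T]: [x = (z + zbar) / 2], [y = (z - zbar) / (2 i)]. *)
pose w k : K[i] := match split k with
  | inl j => ((v (lshift n j))%:R + (v (rshift n j))%:R) / 2%:R
  | inr j => ((v (lshift n j))%:R - (v (rshift n j))%:R) / (2%:R * 'i) end.
have := TE w; rewrite QT0 meval0 => ->; apply: meval_eq => k.
have i0 : 'i != 0 :> K[i] by rewrite eq_complex /= oner_eq0 andbF.
rewrite /w -{1}[k]splitK; case: (split k) => j /=;
  rewrite (unsplitK (inl j)) (unsplitK (inr j)); by field.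
Qed.

(** * Bidegrees *)

Definition zdeg (n : nat) (a : 'X_{1..n + n}) : nat :=
  \sum_(i < n) a (lshift n i).

Definition zbardeg (n : nat) (a : 'X_{1..n + n}) : nat :=
  \sum_(i < n) a (rshift n i).

Lemma zdeg0 n : @zdeg n 0%MM = 0%N.
Proof. by rewrite /zdeg big1 // => i _; rewrite mnm0E. Qed.

Lemma zdegD n : {morph @zdeg n : a b / (a + b)%MM >-> (a + b)%N}.
Proof.
by move=> a b; rewrite /zdeg -big_split; apply: eq_bigr => i _; rewrite mnmDE.
Qed.

Lemma zbardeg0 n : @zbardeg n 0%MM = 0%N.
Proof. by rewrite /zbardeg big1 // => i _; rewrite mnm0E. Qed.

Lemma zbardegD n : {morph @zbardeg n : a b / (a + b)%MM >-> (a + b)%N}.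
Proof.
by move=> a b; rewrite /zbardeg -big_split; apply: eq_bigr => i _; rewrite mnmDE.
Qed.

(** As measures, these two degrees give access to [mmeasure], which is one more than the degree and
    is 0 exactly for the zero polynomial. *)
HB.instance Definition _ n := isMeasure.Build (n + n)%N (@zdeg n)
  (zdeg0 n) (@zdegD n).
HB.instance Definition _ n := isMeasure.Build (n + n)%N (@zbardeg n)
  (zbardeg0 n) (@zbardegD n).

Lemma mmeasure_leP (R : nzRingType) (n : nat) (mf : measure n)
  (P : {mpoly R[n]}) (D : nat) :
  reflect (forall a, a \in msupp P -> (mf a < D)%N) (mmeasure mf P <= D)%N.
Proof.
apply: (iffP idP) => [le a aP|lt].
  exact: leq_trans (mmeasure_mnm_lt mf aP) le.
by rewrite mmeasureE big_seq; apply/bigmax_leqP_seq => a _ /lt.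
Qed.

Lemma mmeasureM_le (R : nzRingType) (n : nat) (mf : measure n)
  (P Q : {mpoly R[n]}) :
  (mmeasure mf (P * Q) <= (mmeasure mf P + mmeasure mf Q).-1)%N.
Proof.
apply/mmeasure_leP => a /msuppM_le /allpairsP[[b c] /= [bP cQ ->]].
have := mmeasure_mnm_lt mf bP; have := mmeasure_mnm_lt mf cQ.
by rewrite mfD; lia.
Qed.

Lemma mmeasureMS_le (R : nzRingType) (n : nat) (mf : measure n)
  (P Q : {mpoly R[n]}) (d e : nat) :
  (mmeasure mf P <= d.+1)%N -> (mmeasure mf Q <= e.+1)%N ->
  (mmeasure mf (P * Q) <= (d + e).+1)%N.
Proof.
move=> Pd Qe; apply: leq_trans (mmeasureM_le _ _ _) _.
by rewrite -subn1 leq_subLR; apply: leq_trans (leq_add Pd Qe) _; lia.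
Qed.

Section Bidegree.
Variables (K : realType) (n : nat).
Implicit Types P Q : {mpoly K[i][n + n]}.

(* Both degrees of [P] are at most [D - 1]; only [0] has [bideg_lt 0]. *)
Definition bideg_lt (D : nat) P : bool :=
  (mmeasure (@zdeg n) P <= D)%N && (mmeasure (@zbardeg n) P <= D)%N.

Lemma bideg_ltP D P : reflect
  (forall a, a \in msupp P -> (zdeg a < D)%N /\ (zbardeg a < D)%N)
  (bideg_lt D P).
Proof.
apply: (iffP andP) => [[/mmeasure_leP lz /mmeasure_leP lw] a aP|lt].
  by split; [apply: lz | apply: lw].
by split; apply/mmeasure_leP => a /lt[].
Qed.

Lemma bideg_ltW D D' P : (D <= D')%N -> bideg_lt D P -> bideg_lt D' P.
Proof. by move=> le /andP[z w]; rewrite /bideg_lt !(leq_trans _ le). Qed.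

Lemma bideg_ltD D P Q : bideg_lt D P -> bideg_lt D Q -> bideg_lt D (P + Q).
Proof.
move=> /andP[z1 w1] /andP[z2 w2]; apply/andP; split;
  by apply: leq_trans (mmeasureD_le _ _ _) _; rewrite geq_max ?z1 ?w1.
Qed.

Lemma bideg_ltZ D c P : bideg_lt D P -> bideg_lt D (c *: P).
Proof.
by move=> /andP[z w]; apply/andP; split; apply: leq_trans (mmeasureZ_le _ _ _) _.
Qed.

Lemma bideg_lt0 D : bideg_lt D 0.
Proof. by rewrite /bideg_lt !mmeasure0. Qed.

Lemma bideg_lt_sum D (I : eqType) (s : seq I) (F : I -> {mpoly K[i][n + n]}) :
  (forall i, i \in s -> bideg_lt D (F i)) -> bideg_lt D (\sum_(i <- s) F i).
Proof.
move=> FD; rewrite big_seq; apply: (big_ind (bideg_lt D)) => //.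
- exact: bideg_lt0.
- exact: bideg_ltD.
Qed.

Lemma bideg_ltM D1 D2 P Q :
  bideg_lt D1 P -> bideg_lt D2 Q -> bideg_lt (D1 + D2).-1 (P * Q).
Proof.
move=> /andP[z1 w1] /andP[z2 w2]; apply/andP; split;
  by apply: leq_trans (mmeasureM_le _ _ _) _; rewrite -!subn1 leq_sub2r ?leq_add.
Qed.

Lemma bideg_lt1 c : bideg_lt 1 c%:MP.
Proof. by rewrite /bideg_lt !mmeasureC; case: (c != 0). Qed.

Lemma zdegU (k : 'I_(n + n)) : zdeg U_(k)%MM = (k < n)%N.
Proof.
rewrite /zdeg; case: (splitP k) => j kj.
  rewrite (bigD1 j) //= big1 => [|i nij]; rewrite mnm1E; last first.
    by apply/eqP; rewrite eqb0; apply: contraNneq nij => /(congr1 val) /= ?;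
      apply/eqP/val_inj => /=; lia.
  by rewrite (_ : k = lshift n j) ?eqxx //; apply: val_inj.
rewrite big1 // => i _; rewrite mnm1E; apply/eqP; rewrite eqb0.
by apply/eqP => /(congr1 val) /=; have := ltn_ord i; lia.
Qed.

Lemma zbardegU (k : 'I_(n + n)) : zbardeg U_(k)%MM = (n <= k)%N.
Proof.
rewrite /zbardeg; case: (splitP k) => j kj.
  rewrite big1 => [|i _]; first by have := ltn_ord j; lia.
  rewrite mnm1E; apply/eqP; rewrite eqb0.
  by apply/eqP => /(congr1 val) /=; have := ltn_ord j; lia.
rewrite (bigD1 j) //= big1 => [|i nij]; rewrite mnm1E; last first.
  by apply/eqP; rewrite eqb0; apply: contraNneq nij => /(congr1 val) /= ?;
      apply/eqP/val_inj => /=; lia.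
have -> : k = rshift n j by apply: val_inj.
rewrite eqxx /=; lia.
Qed.

Lemma bideg_lt_sqnormz : bideg_lt 2 (sqnormz K n).
Proof.
rewrite /sqnormz; apply: bideg_lt_sum => i _; rewrite /zvar /zbarvar -mpolyXD.
rewrite /bideg_lt !mmeasureX /= zdegD zbardegD !zdegU !zbardegU /=.
by have := ltn_ord i; lia.
Qed.

Lemma bideg_lt_sqnormzX i : bideg_lt i.+1 (sqnormz K n ^+ i).
Proof.
elim: i => [|i IH]; first by rewrite expr0 -mpolyC1 bideg_lt1.
by rewrite exprS; have := bideg_ltM bideg_lt_sqnormz IH; apply: bideg_ltW; lia.
Qed.

(** Serves three actions: real scaling with [a = b = t], the unit circle with [b] the conjugate of
    [a], and scaling of z alone with [b = 1]. *)
Lemma mevalX_scale (a b : K[i]) (v v' : 'I_(n + n) -> K[i]) (m : 'X_{1..n + n}) :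
  (forall i, v' (lshift n i) = a * v (lshift n i)) ->
  (forall i, v' (rshift n i) = b * v (rshift n i)) ->
  'X_[m].@[v'] = a ^+ zdeg m * b ^+ zbardeg m * 'X_[m].@[v].
Proof.
move=> vl vr; rewrite !mevalX !big_split_ord /= /zdeg /zbardeg !expr_sum.
have scale (c : K[i]) (f g : 'I_n -> K[i]) (e : 'I_n -> nat) :
    (forall i, f i = c * g i) ->
    \prod_i f i ^+ e i = (\prod_i c ^+ e i) * \prod_i g i ^+ e i.
  by move=> fg; rewrite -big_split; apply: eq_bigr => i _; rewrite fg exprMn.
by rewrite (scale _ _ _ _ vl) (scale _ _ _ _ vr) mulrACA.
Qed.

Lemma sqmod_meval (g : {mpoly K[i][n]}) (v : 'I_(n + n) -> K[i]) :
  (sqmod g).@[v] = g.@[fun i => v (lshift n i)]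
    * (map_mpoly (@conjc K) g).@[fun i => v (rshift n i)].
Proof.
rewrite /sqmod mevalM; congr (_ * _); rewrite [LHS]comp_mpoly_meval;
  by apply: meval_eq => i; rewrite tnth_map tnth_ord_tuple mevalXU.
Qed.

Lemma mmeasure_comp_le (mf : measure (n + n)) (d : nat) (g : {mpoly K[i][n]})
  (t : n.-tuple {mpoly K[i][n + n]}) :
  (forall i, mmeasure mf (tnth t i) <= d.+1)%N ->
  (mmeasure mf (g \mPo t) <= ((msize g).-1 * d).+1)%N.
Proof.
move=> tX; rewrite comp_mpolyE; apply: leq_trans (mmeasure_sum _ _ _ _) _.
apply/bigmax_leqP_seq => a ag _; apply: leq_trans (mmeasureZ_le _ _ _) _.
have le : (mdeg a * d <= (msize g).-1 * d)%N.
  by rewrite leq_mul2r -ltnS (leq_trans (msize_mdeg_lt ag)) ?orbT ?leqSpred.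
apply: leq_trans (_ : (mdeg a * d).+1 <= _)%N => //.
rewrite mdegE big_distrl /=.
apply: (big_ind2 (fun P e => mmeasure mf P <= e.+1)%N).
- by rewrite mmeasure1.
- by move=> P e1 Q e2; apply: mmeasureMS_le.
move=> i _; elim: (a i) => [|e IH]; first by rewrite expr0 mmeasure1.
by rewrite exprS mulSn; apply: mmeasureMS_le.
Qed.

Lemma bideg_lt_sqmod (g : {mpoly K[i][n]}) : bideg_lt (msize g) (sqmod g).
Proof.
have [->|g0] := eqVneq g 0.
  by rewrite /sqmod comp_mpoly0 mul0r bideg_lt0.
have g'E : msize (map_mpoly (@conjc K) g) = msize g.
  by rewrite !msizeE (perm_big _ (msupp_map_mpoly g (can_inj (@conjcK K)))).
(* One factor of [sqmod g] involves only z, the other only zbar: [(d1, d2)] is [(1, 0)] for [zdeg]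
   and [(0, 1)] for [zbardeg]. *)
have zX (mf : measure (n + n)) d1 d2 : (forall i, mf U_(lshift n i)%MM <= d1)%N ->
   (forall i, mf U_(rshift n i)%MM <= d2)%N ->
   (mmeasure mf (sqmod g) <= ((msize g).-1 * (d1 + d2)).+1)%N.
  move=> le1 le2; rewrite mulnDr; apply: mmeasureMS_le.
    by apply: mmeasure_comp_le => i; rewrite tnth_map tnth_ord_tuple mmeasureX ltnS.
  rewrite -g'E.
  by apply: mmeasure_comp_le => i; rewrite tnth_map tnth_ord_tuple mmeasureX ltnS.
have eS : ((msize g).-1 * 1).+1 = msize g by rewrite muln1 -mpolySpred.
rewrite /bideg_lt -eS; apply/andP; split.
  rewrite -[1%N]addn0; apply: zX => i; rewrite /= zdegU /=; have := ltn_ord i; lia.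
rewrite -[1%N]add0n; apply: zX => i; rewrite /= zbardegU /=; have := ltn_ord i; lia.
Qed.

Lemma bidegree_le (D : nat) P : bideg_lt D P ->
  (bidegree P).1 <= D%:Z - 1 /\ (bidegree P).2 <= D%:Z - 1.
Proof.
move=> /bideg_ltP PD; rewrite /bidegree; case: eqP => [_ /=|/eqP P0 /=]; first lia.
(* For [D = 0] only the zero polynomial qualifies, and the bound -1 is its conventional bidegree. *)
have D0 : (0 < D)%N.
  move: P0; rewrite -msupp_eq0; case E: (msupp P) => [//|a s] _.
  have [] : (zdeg a < D)%N /\ (zbardeg a < D)%N by apply: PD; rewrite E mem_head.
  lia.
rewrite -predn_int // !lez_nat; split; apply/bigmax_leqP_seq => a aP _;
  by have [aD wD] := PD a aP; rewrite -ltnS prednK.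
Qed.

End Bidegree.

(** * Division by ||z||^2 - r^2 *)

(** The relation holds degree by degree, so it survives the linear map sending each ['X^i] to an
    arbitrary [g i]. *)
Lemma sum_Xn_eq0 (F : comNzRingType) (I : eqType) (s : seq I) (c : I -> F)
  (k : I -> nat) (g : nat -> F) :
  \sum_(a <- s) c a *: 'X^(k a) = 0 -> \sum_(a <- s) c a * g (k a) = 0.
Proof.
pose B := (\max_(a <- s) k a).+1; move=> p0.
transitivity (\sum_(i < B) g i * (\sum_(a <- s) c a *: 'X^(k a))`_i); last first.
  by rewrite p0 big1 // => i _; rewrite coef0 mulr0.
under [RHS]eq_bigr do rewrite coef_sum big_distrr /=.
rewrite exchange_big [LHS]big_seq [RHS]big_seq; apply: eq_bigr => a as_.
have kB : (k a < B)%N by rewrite ltnS; apply: leq_bigmax_seq.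
rewrite (bigD1 (Ordinal kB)) //= big1 => [|i ni].
  by rewrite addr0 coefZ coefXn eqxx mulr1 mulrC.
rewrite coefZ coefXn; case: eqP => [E|]; last by rewrite !mulr0.
by case/eqP: ni; apply: val_inj.
Qed.

Section Sphere.
Variables (K : realType) (n : nat).
Implicit Types (P Q : {mpoly K[i][n + n]}) (z : 'I_n -> K[i]).

(** The Cayley transform gives infinitely many explicit points of the unit circle, enough to force a
    polynomial in one variable to be 0. *)
Definition cayley (t : nat) : K[i] := (1 + 'i * t%:R) / (1 - 'i * t%:R).

Lemma conj_1Di (t : nat) : (1 + 'i * t%:R : K[i])^* = 1 - 'i * t%:R.
Proof. exact: (conj_natDi K 1). Qed.

Lemma oneDi_neq0 (t : nat) : (1 + 'i * t%:R : K[i]) != 0.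
Proof.
apply/eqP => a0; have := conj_1Di t; rewrite a0 rmorph0 => b0.
have := congr2 +%R a0 (esym b0).
rewrite addrACA subrr !addr0 => /eqP.
by rewrite -mulr2n pnatr_eq0.
Qed.

Lemma cayley_conj t : cayley t * (cayley t)^*%C = 1.
Proof.
have := oneDi_neq0 t; rewrite /cayley -conj_1Di.
move: (1 + 'i * t%:R) => a a0.
by rewrite rmorphM fmorphV /= conjcK mulrACA -invfM
  [X in _ / X]mulrC divff // mulf_neq0 ?conjc_eq0.
Qed.

Lemma cayley_inj : injective cayley.
Proof.
move=> s t; rewrite /cayley => /eqP.
rewrite eqr_div -?conj_1Di ?conjc_eq0 ?oneDi_neq0 // !conj_1Di -subr_eq0.
have -> : (1 + 'i * s%:R) * (1 - 'i * t%:R) - (1 + 'i * t%:R) * (1 - 'i * s%:R)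
  = 2%:R * 'i * (s%:R - t%:R) :> K[i] by ring.
have i0 : 'i != 0 :> K[i] by rewrite eq_complex /= oner_eq0 andbF.
rewrite !mulf_eq0 pnatr_eq0 (negPf i0) /= subr_eq0 eqr_nat.
by move/eqP.
Qed.

Lemma enorm_ge0 z : 0 <= enorm z.
Proof. exact: sqrtr_ge0. Qed.

Lemma enormZ (a : K[i]) (c : K) z :
  `|a| = c%:C -> enorm (fun i => a * z i) = c * enorm z.
Proof.
move=> ac; have c0 : 0 <= c by rewrite -lecR -ac normr_ge0.
apply/eqP; rewrite -(eqrXn2 (n := 2)) ?mulr_ge0 ?enorm_ge0 //; apply/eqP.
apply: (@complexI K); rewrite enorm_sqr exprMn rmorphM /= enorm_sqr mulr_sumr.
apply: eq_bigr => i _.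
by rewrite normrM exprMn ac -rmorphXn.
Qed.

Lemma enorm_real (c : K) z : 0 <= c -> enorm (fun i => c%:C * z i) = c * enorm z.
Proof.
by move=> c0; apply: enormZ;
  rewrite normc_def /= expr0n addr0 sqrtr_sqr ger0_norm.
Qed.

Lemma enorm_sphereP (r : K) z : (0 < n)%N -> 0 < r ->
  exists (t : K) (u : 'I_n -> K[i]),
    [/\ 0 <= t, enorm u = r & forall i, z i = t%:C * u i].
Proof.
move=> n0 r0; have [z0|z0] := eqVneq (enorm z) 0.
  (* At the origin [t = 0], and any point of the sphere serves as [u]. *)
  exists 0, (fun i => r%:C * (i == Ordinal n0)%:R); split=> //.
    rewrite enorm_real ?ltW // -[RHS]mulr1; congr (_ * _).
    rewrite /enorm (bigD1 (Ordinal n0)) //= big1 => [|i /negPf ->].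
      by rewrite addr0 /= expr0n addr0 expr1n sqrtr1.
    by rewrite /= expr0n addr0.
  move=> i; rewrite mul0r; apply/eqP; rewrite -normr_eq0 -sqrf_eq0.
  have := enorm_sqr z; rewrite z0 expr0n /= => /esym/eqP.
  rewrite psumr_eq0 => [/allP/(_ i)|j _]; last by rewrite exprn_ge0.
  by rewrite mem_index_enum => /(_ isT).
have zp : 0 < enorm z by rewrite lt_def z0 enorm_ge0.
exists (enorm z / r), (fun i => (r / enorm z)%:C * z i); split.
- by rewrite divr_ge0 ?enorm_ge0 ?ltW.
- by rewrite enorm_real ?divr_ge0 ?enorm_ge0 ?ltW // divfK.
move=> i; rewrite mulrA -rmorphM /= mulrA divfK ?gt_eqF // divff //.
by rewrite mul1r.
Qed.

(* The exponent of [||z||^2 / r^2] gives all monomials of equal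
   [zdeg - zbardeg] the same bidegree, without changing [P] on the sphere. *)
Definition sphhomog (D : nat) (r : K) P : {mpoly K[i][n + n]} :=
  \sum_(a <- msupp P) P@_a *:
    ('X_[a] * ((r ^- 2)%:C *: sqnormz K n) ^+ (D - maxn (zdeg a) (zbardeg a))).

Lemma sphhomog_eq0 (D : nat) (r : K) P : (0 < n)%N -> 0 < r ->
  bideg_lt D.+1 P -> (forall z, enorm z = r -> P.@[zzbar z] = 0) ->
  sphhomog D r P = 0.
Proof.
move=> n0 r0 /bideg_ltP PD Pr; apply: zzbar_eq0 => z.
have [t [u [t0 ur zE]]] := enorm_sphereP z n0 r0.
have zz a : 'X_[a].@[zzbar z] =
    t%:C ^+ zdeg a * t%:C ^+ zbardeg a * 'X_[a].@[zzbar u].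
  apply: mevalX_scale => i; rewrite ?zzbar_lshift ?zzbar_rshift zE //.
  by rewrite rmorphM; congr (_ * _); apply: conjc_real.
have sE : ((r ^- 2)%:C *: sqnormz K n).@[zzbar z] = t%:C ^+ 2.
  rewrite mevalZ sqnormzE -!rmorphXn -rmorphM; congr (_%:C).
  have -> : enorm z = t * r.
    rewrite -ur -enorm_real // /enorm; congr Num.sqrt.
    by apply: eq_bigr => i _; rewrite zE.
  by rewrite exprMn mulrC mulfK // expf_neq0 // gt_eqF.
(* Rotating [u] by a unit number [c] keeps it on the sphere and multiplies each monomial by
   [c ^ (zdeg - zbardeg)]; the shift by [D] makes this exponent nonnegative. *)
have h0 : \sum_(a <- msupp P)
    (P@_a * 'X_[a].@[zzbar u]) *: 'X^(D + zdeg a - zbardeg a) = 0 :> {poly K[i]}.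
  apply: (poly_eq0_inj cayley_inj) => s.
  transitivity (cayley s ^+ D * P.@[zzbar (fun i => cayley s * u i)]); last first.
    rewrite Pr ?mulr0 // (@enormZ _ 1) ?mul1r //.
    apply/eqP; rewrite -(eqrXn2 (n := 2)) ?normr_ge0 //.
    by rewrite sqr_normc cayley_conj expr1n.
  rewrite [P in RHS]mpolyE raddf_sum mulr_sumr horner_sum /= big_seq [RHS]big_seq.
  apply: eq_bigr => a /PD[_ aD].
  rewrite hornerZ hornerXn mevalZ.
  rewrite (@mevalX_scale _ _ (cayley s) (cayley s)^*%C (zzbar u)
    (zzbar (fun i => cayley s * u i))); first last.
  - by move=> i; rewrite !zzbar_rshift rmorphM.
  - by move=> i; rewrite !zzbar_lshift.
  have -> : cayley s ^+ (D + zdeg a - zbardeg a) =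
      cayley s ^+ (D + zdeg a) * (cayley s)^*%C ^+ zbardeg a.
    have {2}-> : (D + zdeg a)%N = (D + zdeg a - zbardeg a + zbardeg a)%N by lia.
    by rewrite exprD -mulrA -exprMn cayley_conj expr1n mulr1.
  by rewrite exprD; ring.
rewrite /sphhomog raddf_sum /=.
(* With [k = D + zdeg - zbardeg], the truncated differences add up to [|zdeg - zbardeg|], and
   [2 D - |zdeg - zbardeg|] is the power of [t] that every term of [sphhomog] carries at
   [z = t u]. *)
rewrite -[RHS](sum_Xn_eq0
  (fun k => t%:C ^+ (2 * D - ((k - D) + (D - k)))%N) h0).
rewrite big_seq [RHS]big_seq; apply: eq_bigr => a /PD[zD wD].
rewrite mevalZ mevalM zz rmorphXn /= sE -exprM -exprD.
rewrite -!mulrA [RHS]mulrCA mulrCA; congr (_ * _); rewrite mulrC -mulrA; congr (_ * _).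
by rewrite -exprD; congr (_ ^+ _); lia.
Qed.

(** The quotient of [P - sphhomog D r P]. With [s = ||z||^2 / r^2], the geometric sum divides
    [1 - s ^ e] by [1 - s], and the factor [- r ^- 2] turns [||z||^2 - r^2] into [1 - s]. *)
Definition sphquot (D : nat) (r : K) P : {mpoly K[i][n + n]} :=
  - (r ^- 2)%:C *: \sum_(a <- msupp P) P@_a *: ('X_[a] *
    \sum_(i < D - maxn (zdeg a) (zbardeg a)) ((r ^- 2)%:C *: sqnormz K n) ^+ i).

Lemma sphquotE (D : nat) (r : K) P : (0 < n)%N -> 0 < r ->
  bideg_lt D.+1 P -> (forall z, enorm z = r -> P.@[zzbar z] = 0) ->
  P = sphquot D r P * (sqnormz K n - ((r ^+ 2)%:C)%:MP).
Proof.
move=> n0 r0 PD Pr; have H0 := sphhomog_eq0 n0 r0 PD Pr.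
rewrite -[LHS]subr0 -H0 {1}[P]mpolyE /sphhomog -sumrB /sphquot.
rewrite -scalerAl scalerAr.
have -> : - (r ^- 2)%:C *: (sqnormz K n - ((r ^+ 2)%:C)%:MP) =
   1 - (r ^- 2)%:C *: sqnormz K n.
  rewrite scalerBr !scaleNr opprK addrC; congr (_ - _).
  rewrite -mul_mpolyC -mpolyCM -rmorphM mulVf //.
  by rewrite expf_neq0 // gt_eqF.
rewrite mulr_suml; apply: eq_bigr => a _.
rewrite -scalerBr -scalerAl; congr (_ *: _).
rewrite -{1}['X_[a]]mulr1 -mulrBr -mulrA; congr (_ * _).
by rewrite -[LHS]opprB subrX1 -mulNr opprB mulrC.
Qed.

Lemma bideg_lt_sphquot (D : nat) (r : K) P :
  bideg_lt D.+1 P -> bideg_lt D (sphquot D r P).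
Proof.
move=> /bideg_ltP PD; apply/bideg_ltZ/bideg_lt_sum => a aP; apply: bideg_ltZ.
rewrite mulr_sumr; apply: bideg_lt_sum => -[i /= iD] _.
have XA : bideg_lt (maxn (zdeg a) (zbardeg a)).+1 ('X_[a] : {mpoly K[i][n + n]}).
  by rewrite /bideg_lt !mmeasureX /= !ltnS leq_maxl leq_maxr.
rewrite exprZn -scalerAr; apply: bideg_ltZ.
(* Both degrees are at most [maxn (zdeg a) (zbardeg a) + i], which is below [D] by the range of
   [i]. *)
by apply: bideg_ltW (bideg_ltM XA (bideg_lt_sqnormzX K n i)); lia.
Qed.

End Sphere.

(** * Reality of the quotient and the degree bound on [q] *)

Section Main.
Variables (K : realType) (n : nat).
Implicit Types (P Q : {mpoly K[i][n + n]}) (z : 'I_n -> K[i]).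

Lemma CrealP (x : K[i]) : reflect (x^* = x) (x \is Num.real).
Proof. by rewrite CrealE; apply: eqP. Qed.

(** Conjugating the coefficients and swapping z with zbar makes reality of [Q] the polynomial
    identity [conjp Q = Q]. *)
Definition conjp Q : {mpoly K[i][n + n]} :=
  map_mpoly (@conjc K) Q \mPo
    [tuple match split k with inl j => zbarvar K j | inr j => zvar K j end
       | k < n + n].

Lemma conjpE Q z : (conjp Q).@[zzbar z] = (Q.@[zzbar z])^*.
Proof.
rewrite -(meval_conj Q) [LHS]comp_mpoly_meval; apply: meval_eq => k.
rewrite tnth_map tnth_ord_tuple -{2}[k]splitK.
by case: (split k) => j /=; rewrite mevalXU !(zzbar_lshift, zzbar_rshift) ?conjcK.
Qed.

Lemma sphere_factorE (r : K) z :
  (sqnormz K n - ((r ^+ 2)%:C)%:MP).@[zzbar z] = (enorm z ^+ 2 - r ^+ 2)%:C.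
Proof. by rewrite mevalB sqnormzE mevalC rmorphB. Qed.

(** Dividing values would fail on the sphere itself. Instead [conjp Q - Q] times the factor vanishes
    at every [zzbar w], hence is 0, and the factor is a nonzero element of a domain. *)
Lemma real_poly_sphere_factor (r : K) Q : 0 < r ->
  real_poly (Q * (sqnormz K n - ((r ^+ 2)%:C)%:MP)) -> real_poly Q.
Proof.
move=> r0 realP z; apply/CrealP; rewrite -conjpE; congr (_.@[_]).
apply/eqP; rewrite -subr_eq0.
have s0 : sqnormz K n - ((r ^+ 2)%:C)%:MP != 0.
  apply/eqP => /(congr1 (fun P => P.@[zzbar (fun=> 0)])).
  rewrite sphere_factorE meval0 => /(@complexI K)/eqP.
  rewrite /enorm big1 => [|i _]; last by rewrite /= expr0n addr0.
  by rewrite sqrtr0 expr0n sub0r oppr_eq0 sqrf_eq0 gt_eqF.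
rewrite -(mulIr_eq0 _ (mulIf s0)); apply/eqP/zzbar_eq0 => w.
have /CrealP := realP w; rewrite mevalM sphere_factorE => E.
rewrite mevalM mevalB sphere_factorE conjpE mulrBl -[X in _ - X]E rmorphM.
by apply/eqP; rewrite subr_eq0; apply/eqP; congr (_ * _); rewrite [RHS]conjc_real.
Qed.

(** Orthogonal pairs are parametrized polynomially by [(z, v)]. Pulled back to these parameters, [A]
    and [B] stay nonzero, so their product is nonzero somewhere. *)
Lemma orthogonal_neq0 (A B : {mpoly K[i][n]}) : (2 <= n)%N -> A != 0 -> B != 0 ->
  exists z w : 'I_n -> K[i],
    [/\ \sum_i z i * w i = 0, A.@[z] != 0 & B.@[w] != 0].
Proof.
move=> n2 A0 B0.
pose i0 := Ordinal (ltnW n2 : 0 < n)%N; pose i1 := Ordinal n2.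
have ni : (i1 == i0) = false by [].
(* [w = z_0 v - (z . v) e_0] is orthogonal to [z], for all [z] and [v]. *)
pose W := [tuple zvar K i0 * zbarvar K i - (i == i0)%:R *: sqnormz K n | i < n].
have WE v i : (tnth W i).@[v] = v (lshift n i0) * v (rshift n i)
    - (i == i0)%:R * \sum_j v (lshift n j) * v (rshift n j).
  rewrite tnth_map tnth_ord_tuple mevalB mevalM mevalZ !mevalXU.
  by rewrite /sqnormz raddf_sum; congr (_ - _ * _); apply: eq_bigr => j _;
    rewrite /= mevalM !mevalXU.
pose join (z v : 'I_n -> K[i]) (k : 'I_(n + n)) :=
  match split k with inl j => z j | inr j => v j end.
have joinl z v i : join z v (lshift n i) = z i by rewrite /join (unsplitK (inl i)).
have joinr z v i : join z v (rshift n i) = v i by rewrite /join (unsplitK (inr i)).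
have A'E v : (A \mPo [tuple zvar K i | i < n]).@[v] = A.@[fun i => v (lshift n i)].
  rewrite [LHS]comp_mpoly_meval; apply: meval_eq => i.
  by rewrite tnth_map tnth_ord_tuple mevalXU.
have A'0 : A \mPo [tuple zvar K i | i < n] != 0.
  have [z /eqP Az] := mpoly_neq0_nat A0.
  apply: contra_notN Az => /eqP A'0; set z' := (fun i => _).
  transitivity ((A \mPo [tuple zvar K i | i < n]).@[join z' z']).
    by rewrite A'E; apply: meval_eq => i; rewrite joinl.
  by rewrite A'0 meval0.
have B'0 : B \mPo W != 0.
  have BX : B * 'X_i1 != 0.
    by rewrite mulf_neq0 // -msize_poly_eq0 msizeX.
  have [w] := mpoly_neq0_nat BX.
  set w' := (fun i => _); rewrite mevalM mevalXU mulf_eq0 => /norP[/eqP Bw w1].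
  apply: contra_notN Bw => /eqP B'0.
  (* This [z] is orthogonal to [w'] and has [z_0 = 1], so the parametrization sends [(z, w')] to
     [w'], where [B] does not vanish. *)
  pose z i : K[i] := (i == i0)%:R - (i == i1)%:R * (w' i0 / w' i1).
  have zw : \sum_j z j * w' j = 0.
    rewrite (bigD1 i0) // (bigD1 i1) //= big1 => [|j /andP[/negPf j0 /negPf j1]].
      rewrite /z !eqxx ni eq_sym ni mul0r mul1r subr0 mul1r sub0r addr0.
      by rewrite mulNr divfK ?subrr.
    by rewrite /z j0 j1 mul0r subrr mul0r.
  transitivity ((B \mPo W).@[join z w']).
    rewrite [RHS]comp_mpoly_meval; apply: meval_eq => i; rewrite WE joinl joinr.
    under eq_bigr do rewrite joinl joinr.
    by rewrite zw mulr0 subr0 /z eqxx eq_sym ni mul0r subr0 mul1r.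
  by rewrite B'0 meval0.
have [v] := mpoly_neq0_nat (mulf_neq0 A'0 B'0).
move: (fun i => _) => v'; rewrite mevalM mulf_eq0 => /norP[Av Bv].
rewrite A'E in Av.
have {}Bv : B.@[fun i => (tnth W i).@[v']] != 0.
  by apply: contraNneq Bv => Bv; apply/eqP; rewrite [LHS]comp_mpoly_meval.
exists (fun i => v' (lshift n i)), (fun i => (tnth W i).@[v']).
split; [ | exact: Av | exact: Bv].
pose S := \sum_j v' (lshift n j) * v' (rshift n j).
transitivity (v' (lshift n i0) * S - v' (lshift n i0) * S); last exact: subrr.
rewrite {1}/S mulr_sumr.
transitivity (\sum_i (v' (lshift n i0) * (v' (lshift n i) * v' (rshift n i))
    - (if i == i0 then v' (lshift n i0) * S else 0))).
  apply: eq_bigr => i _; rewrite WE -/S mulrBr mulrCA; congr (_ - _).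
  by case: eqP => [->|_]; rewrite ?mul1r ?mul0r ?mulr0.
by rewrite sumrB -big_mkcond big_pred1_eq -mulr_sumr.
Qed.

(** The leading monomial has top degree, so its coefficient survives in this part. *)
Lemma pihomog_top (q : {mpoly K[i][n]}) : q != 0 ->
  pihomog mdeg (msize q).-1 q != 0.
Proof.
move=> q0; have lm := mlead_deg q0.
apply: contraNneq q0 => /(congr1 (fun g : {mpoly K[i][n]} => g@_(mlead q))).
rewrite pihomogE -big_filter raddf_sum /= mcoeff0.
case: (boolP (mlead q \in msupp q)) => [lq|]; last
  by rewrite -mleadc_eq0 mcoeff_msupp negbK.
rewrite (bigD1_seq (mlead q)) ?filter_uniq ?msupp_uniq //=; last first.
  by rewrite mem_filter lq -lm eqxx.
rewrite big1 => [|a /negPf na]; last by rewrite mcoeffZ mcoeffX na mulr0.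
by rewrite mcoeffZ mcoeffX eqxx mulr1 addr0 => /eqP; rewrite mleadc_eq0.
Qed.

(* Evaluate the factorization at [(t z, w)], where [z . w = 0], the top
   homogeneous part of [q] is nonzero at [z] and the conjugate of [q] at [w]:
   the factor [z . w - r^2] is then constant, and comparing the degrees in [t]
   gives the bound. *)
Lemma msize_le_sphere (D : nat) (r : K) (b : K[i]) (q : {mpoly K[i][n]}) Q :
  (2 <= n)%N -> 0 < r -> b != 0 -> q != 0 -> bideg_lt D Q ->
  (forall z, enorm z = r -> (Q - b *: sqmod q).@[zzbar z] = 0) ->
  (msize q <= D)%N.
Proof.
move=> n2 r0 b0 q0 QD Pr; rewrite leqNgt; apply/negP => Dq.
pose d := (msize q).-1.
have qd : msize q = d.+1 by rewrite /d -mpolySpred.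
have Qd : bideg_lt d Q by apply: bideg_ltW QD; rewrite -ltnS -qd.
have Pd : bideg_lt d.+1 (Q - b *: sqmod q).
  apply: bideg_ltD; first by apply: bideg_ltW Qd.
  by rewrite -scaleNr; apply: bideg_ltZ; rewrite -qd bideg_lt_sqmod.
(* If [D < msize q = d + 1], then both [Q] and the quotient [Q'] have degrees below [d], so only [q]
   can contribute to [t ^ d]. *)
have := sphquotE (ltnW n2) r0 Pd Pr; have := bideg_lt_sphquot r Pd.
move: (sphquot _ _ _) => Q' Q'd PE.
have q'0 : map_mpoly (@conjc K) q != 0.
  rewrite -msupp_eq0; apply: contraNneq q0 => s0; rewrite -msupp_eq0.
  by rewrite -size_eq0 -(perm_size (msupp_map_mpoly q (can_inj (@conjcK K)))) s0.
have [z [w [zw qz qw]]] := orthogonal_neq0 n2 (pihomog_top q0) q'0.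
pose v (t : K[i]) (k : 'I_(n + n)) :=
  match split k with inl j => t * z j | inr j => w j end.
have vl t i : v t (lshift n i) = t * z i by rewrite /v (unsplitK (inl i)).
have vr t i : v t (rshift n i) = w i by rewrite /v (unsplitK (inr i)).
pose h (P : {mpoly K[i][n + n]}) : {poly K[i]} :=
  \sum_(a <- msupp P) (P@_a * 'X_[a].@[v 1]) *: 'X^(zdeg a).
have hE P t : (h P).[t] = P.@[v t].
  rewrite {2}[P]mpolyE raddf_sum horner_sum; apply: eq_bigr => a _ /=.
  rewrite hornerZ hornerXn mevalZ (@mevalX_scale _ _ t 1 (v 1) (v t)).
  - by rewrite expr1n mulr1 -mulrA [X in _ * X]mulrC.
  - by move=> i; rewrite !vl mul1r.
  - by move=> i; rewrite !vr mul1r.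
have h_top P : bideg_lt d P -> (h P)`_d = 0.
  move=> /bideg_ltP Pd'; rewrite coef_sum big_seq big1 // => a /Pd'[aD _].
  by rewrite coefZ coefXn gtn_eqF ?mulr0.
pose g : {poly K[i]} := \sum_(a <- msupp q) (q@_a * 'X_[a].@[z]) *: 'X^(mdeg a).
have gE t : g.[t] = q.@[fun i => t * z i].
  rewrite [q in RHS]mpolyE raddf_sum horner_sum; apply: eq_bigr => a _ /=.
  rewrite hornerZ hornerXn mevalZ !mevalX -mulrA; congr (_ * _).
  rewrite mdegE expr_sum -big_split; apply: eq_bigr => i _.
  by rewrite exprMn mulrC.
have g_top : g`_d = (pihomog mdeg d q).@[z].
  rewrite coef_sum pihomogE raddf_sum [RHS]big_mkcond /=; apply: eq_bigr => a _.
  rewrite coefZ coefXn mevalZ eq_sym; case: eqP => _; by rewrite ?mulr1 ?mulr0.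
(* On the line [(t z, w)] the factor [z . w - r^2] is [- r^2], which makes the factorization linear
   in [h Q], [g] and [h Q']. *)
have E : h Q - (b * (map_mpoly (@conjc K) q).@[w]) *: g + (r ^+ 2)%:C *: h Q' = 0.
  apply: (@poly_eq0_inj _ (fun t : nat => t%:R)) => [s t /eqP|t].
    by rewrite eqr_nat => /eqP.
  rewrite hornerD hornerD hornerN !hornerZ !hE gE.
  have := congr1 (fun P => P.@[v t%:R]) PE.
  rewrite mevalB mevalZ sqmod_meval mevalM mevalB mevalC.
  rewrite (_ : (sqnormz K n).@[_] = 0); last first.
    rewrite raddf_sum -[RHS](mulr0 t%:R) -[in RHS]zw mulr_sumr.
    by apply: eq_bigr => i _; rewrite /= mevalM !mevalXU vl vr mulrA.
  rewrite (meval_eq (v2 := fun i => t%:R * z i)); last by move=> i; rewrite vl.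
  rewrite (meval_eq (v2 := w) (map_mpoly _ q)); last by move=> i; rewrite vr.
  rewrite sub0r mulrN => /(congr1 (fun x => x + Q'.@[v t%:R] * (r ^+ 2)%:C)).
  rewrite addNr => <-; ring.
have := congr1 (fun f : {poly K[i]} => f`_d) E.
rewrite coefD coefB !coefZ h_top // h_top // g_top mulr0 addr0 sub0r coef0.
by move/eqP; rewrite oppr_eq0 !mulf_eq0 (negPf b0) (negPf qz) (negPf qw).
Qed.

End Main.

(** * The successive quotients and divided differences *)

Section Divdiff.
Variables (K : realType) (n N k m : nat).
Variables (p : 'I_N -> {mpoly K[i][n]}) (q : {mpoly K[i][n]}) (r R : nat -> K).

(** The argument [m - j'] is the degree bound of the dividend; each division lowers it by one. *)
Fixpoint quotseq (j : nat) : {mpoly K[i][n + n]} :=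
  if j is j'.+1 then
    sphquot (m - j') (r j) (quotseq j' - (bcoef r R j')%:C *: sqmod q)
  else sqnorm p.

Definition quotseq_spec (j : nat) : Prop :=
  [/\ real_poly (quotseq j), bideg_lt (m.+1 - j) (quotseq j) &
      forall l, (j < l <= k)%N -> forall z, enorm z = r l ->
        (quotseq j).@[zzbar z] = (divdiff r R j l)%:C * `|q.@[z]| ^+ 2].

Hypotheses (hn : (2 <= n)%N) (hkm : (k <= m.+1)%N) (hq : q != 0).
Hypothesis hdeg : ratmap_degree p q = m.
Hypothesis hsph : sphere_map p q k r R.

Lemma msize_p i : (msize (p i) <= m.+1)%N.
Proof.
have : (pdeg (p i) <= m)%N.
  rewrite -hdeg /ratmap_degree leq_max; apply/orP; left.
  exact: (leq_bigmax (F := fun i => pdeg (p i))).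
by rewrite /pdeg -subn1 leq_subLR.
Qed.

Lemma quotseq_spec0 : quotseq_spec 0.
Proof.
split=> [z||l lk z zl].
- by rewrite sqnormE; apply/CrealP; rewrite conjc_real.
- rewrite subn0 /= /sqnorm; apply: bideg_lt_sum => i _.
  by apply: bideg_ltW (bideg_lt_sqmod _); apply: msize_p.
have [_ _ /(_ l lk z zl)[qz Rl]] := hsph.
rewrite /= -Rl enorm_sqr mulr_suml /sqnorm raddf_sum; apply: eq_bigr => i _ /=.
by rewrite sqmodE -exprMn -normrM /ratmap divfK.
Qed.

Lemma quotseq_vanish j : quotseq_spec j -> (j < k)%N ->
  forall z, enorm z = r j.+1 ->
    (quotseq j - (bcoef r R j)%:C *: sqmod q).@[zzbar z] = 0.
Proof.
move=> [_ _ sph] jk z zr; rewrite mevalB mevalZ sqmodE (sph j.+1) ?subrr //.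
by rewrite ltnSn.
Qed.

Lemma r_gt0 j : (0 < j <= k)%N -> 0 < r j.
Proof. by have [pos _ _] := hsph => /pos[]. Qed.

Lemma quotseq_degree j : quotseq_spec j -> (j < k)%N -> bcoef r R j != 0 ->
  (msize q <= m.+1 - j)%N.
Proof.
move=> spec jk b0; have [_ bd _] := spec.
apply: (msize_le_sphere hn (@r_gt0 j.+1 jk) _ hq bd (quotseq_vanish spec jk)).
by rewrite -(inj_eq (@complexI K)) in b0.
Qed.

(** Only the term in [sqmod q] could exceed the bound. It is absent when [b_j = 0], and otherwise
    [quotseq_degree] bounds the degree of [q] by [m - j]. *)
Lemma quotseq_bound j : quotseq_spec j -> (j < k)%N ->
  bideg_lt (m - j).+1 (quotseq j - (bcoef r R j)%:C *: sqmod q).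
Proof.
move=> spec jk; rewrite -subSn; last by rewrite -ltnS (leq_trans jk).
have [_ bd _] := spec; apply: bideg_ltD => //; rewrite -scaleNr.
have [->|b0] := eqVneq (bcoef r R j) 0; first by rewrite oppr0 scale0r bideg_lt0.
apply/bideg_ltZ/(bideg_ltW _ (bideg_lt_sqmod _)).
exact: quotseq_degree.
Qed.

Lemma quotseqE j : quotseq_spec j -> (j < k)%N ->
  quotseq j - (bcoef r R j)%:C *: sqmod q =
    quotseq j.+1 * (sqnormz K n - ((r j.+1 ^+ 2)%:C)%:MP).
Proof.
move=> spec jk; apply: sphquotE.
- exact: ltnW.
- exact: r_gt0.
- exact: quotseq_bound.
- exact: quotseq_vanish.
Qed.

Lemma quotseq_specS j : quotseq_spec j -> (j < k)%N -> quotseq_spec j.+1.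
Proof.
move=> spec jk; have [re bd sph] := spec; have E := quotseqE spec jk; split.
- apply: (@real_poly_sphere_factor _ _ (r j.+1)); first exact: r_gt0.
  rewrite -E => z; rewrite mevalB mevalZ rpredB // rpredM //.
    by apply/CrealP; rewrite conjc_real.
  by rewrite sqmodE rpredX // normr_real.
- by rewrite subSS; apply: bideg_lt_sphquot; apply: quotseq_bound.
move=> l /andP[jl lk] z zl.
(* On the sphere of radius [r l] the factor is the nonzero constant [r_l^2 - r_(j+1)^2]; dividing by
   it is the recursion for divided differences. *)
have := congr1 (fun P => P.@[zzbar z]) E.
rewrite mevalB mevalZ sqmodE mevalM sphere_factorE zl (sph l) //; last first.
  by rewrite lk (ltnW jl).
rewrite -mulrBl => E'.
have rl0 : r l ^+ 2 - r j.+1 ^+ 2 != 0.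
  have [_ inj _] := hsph.
  have l0k : (0 < l <= k)%N by rewrite lk andbT; lia.
  rewrite subr_eq0 eqrXn2 ?ltW ?r_gt0 //.
  by apply: contraTneq jl => /(inj l j.+1 l0k jk) ->; rewrite ltnn.
have rl0' : (r l ^+ 2 - r j.+1 ^+ 2)%:C != 0.
  by rewrite -[0]/(0%:C) (inj_eq (@complexI K)).
apply: (mulIf rl0'); rewrite -E' [divdiff r R j.+1 l]/=.
by rewrite mulrAC -rmorphM /= divfK // rmorphB.
Qed.

Lemma quotseqP j : (j <= k)%N -> quotseq_spec j.
Proof.
elim: j => [|j IH] jk; first exact: quotseq_spec0.
by apply: quotseq_specS => //; apply: IH; apply: ltnW.
Qed.

End Divdiff.

Theorem lemma3p10 (K : realType) (n N k m : nat)
  (p : 'I_N -> {mpoly K[i][n]}) (q : {mpoly K[i][n]}) (r R : nat -> K)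
  (hn : (2 <= n)%N) (hk1 : (1 <= k)%N) (hkm : (k <= m.+1)%N)
  (hred : reduced p q) (hdeg : ratmap_degree p q = m)
  (hsph : sphere_map p q k r R) :
  (exists Q : nat -> {mpoly K[i][n + n]},
    Q 0%N = sqnorm p /\
    forall j, (1 <= j <= k)%N ->
      [/\ real_poly (Q j),
          (bidegree (Q j)).1 <= m%:Z - j%:Z /\
          (bidegree (Q j)).2 <= m%:Z - j%:Z,
          forall z : 'I_n -> K[i], enorm z = r j ->
            (Q j.-1).@[zzbar z] / `|q.@[z]| ^+ 2 = (bcoef r R j.-1)%:C,
          Q j.-1 - (bcoef r R j.-1)%:C *: sqmod q =
            Q j * (sqnormz K n - ((r j ^+ 2)%:C)%:MP)
        & forall l, (j.+1 <= l <= k)%N ->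
            forall z : 'I_n -> K[i], enorm z = r l ->
              (Q j).@[zzbar z] / `|q.@[z]| ^+ 2 = (divdiff r R j l)%:C])
  /\
  (forall j, (1 <= j <= k.-1)%N -> bcoef r R j != 0 -> (pdeg q <= m - j)%N).
Proof.
have [hq _] := hred; have spec := quotseqP hn hkm hq hdeg hsph.
(* Dividing by [|q|^2] is legitimate because [q] has no zeros on these spheres. *)
have quot j l : (j < l <= k)%N -> forall z : 'I_n -> K[i], enorm z = r l ->
    (quotseq m p q r R j).@[zzbar z] / `|q.@[z]| ^+ 2 = (divdiff r R j l)%:C.
  move=> /andP[jl lk] z zl; have [_ _ sph] := spec j (ltnW (leq_trans jl lk)).
  have [_ _ /(_ l _ z zl)[|qz _]] := hsph; first by rewrite lk (leq_trans _ jl).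
  by rewrite (sph l) ?jl // mulfK // expf_neq0 // normr_eq0.
split.
  exists (quotseq m p q r R); split=> // -[//|j] /= jk.
  have [re bd sph] := spec j.+1 jk; split=> //.
  (* The natural subtraction is exact since [j + 1 <= k <= m + 1]; for [j = m] the bound is -1 and
     the quotient is 0. *)
  - have -> : m%:Z - j.+1%:Z = (m.+1 - j.+1)%N%:Z - 1 by lia.
    exact: bidegree_le.
  - by apply: quot; rewrite ltnSn.
  - exact: (quotseqE hn hkm hq hsph (spec j (ltnW jk)) jk).
  - exact: quot.
move=> j jk b0; have jk' : (j < k)%N by lia.
have := quotseq_degree hn hq hsph (spec j (ltnW jk')) jk' b0.
by rewrite /pdeg; lia.
Qed.
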